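(* Let $Sp(K,S)$ and $Sp'(K',S')$ be (disjoint) split graphs with $|K|=|S|$ and $|K'|=|S'|$. Then $Sp\circ Sp'$ is nonsingular if and only if $Sp$ and $Sp'$ are both nonsingular.
   Context: Graphs are finite and simple. A split graph is a graph $Sp$ whose vertex set is a disjoint union of a clique $K$ and an independent set $S$; the pair $(K,S)$ is called an s-partition, and $Sp(K,S)$ denotes $Sp$ together with this s-partition. Both parts of an s-partition are assumed nonempty. A graph is nonsingular if its adjacency matrix is invertible. For a split graph $Sp(K,S)$ and a graph $G$ disjoint from it, the Tyshkevich composition $Sp\circ G$ is the graph with vertex set $V(Sp)\cup V(G)$ and edge set $E(Sp)\cup E(G)\cup\{xy: x\in K,\ y\in V(G)\}$. *)

(* Defs.v *)
From mathcomp Require Import all_boot all_order all_algebra.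

Set Implicit Arguments.
Unset Strict Implicit.
Unset Printing Implicit Defensive.

Import GRing.Theory.
Local Open Scope ring_scope.

Record sgraph := SGraph {
  vertex :> finType;
  edge : rel vertex;
  edge_sym : symmetric edge;
  edge_irrefl : irreflexive edge
}.

Definition clique (G : sgraph) (K : {set G}) : Prop :=
  {in K &, forall x y, x != y -> edge x y}.

Definition independent (G : sgraph) (S : {set G}) : Prop :=
  {in S &, forall x y, ~~ edge x y}.

Definition s_partition (G : sgraph) (K S : {set G}) : Prop :=
  [/\ K :|: S = [set: G], [disjoint K & S], K != set0, S != set0
    & clique K /\ independent S].

(* A split graph together with a chosen s-partition, i.e. Sp(K,S) and not just
   the underlying graph Sp. *)
Record split_graph := SplitGraph {
  split_base :> sgraph;
  Kpart : {set split_base};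
  Spart : {set split_base};
  split_partition : s_partition Kpart Spart
}.

(* Disjointness of the two graphs is realised by taking the sum of the two
   vertex types. *)
Section Composition.
Variables (Sp : split_graph) (G : sgraph).

Definition comp_edge (u v : Sp + G) : bool :=
  match u, v with
  | inl x, inl y => edge x y
  | inr x, inr y => edge x y
  | inl x, inr _ => x \in Kpart Sp
  | inr _, inl y => y \in Kpart Sp
  end.

Lemma comp_edge_sym : symmetric comp_edge.
Proof. by move=> [x|x] [y|y] //=; rewrite edge_sym. Qed.

Lemma comp_edge_irrefl : irreflexive comp_edge.
Proof. by move=> [x|x] /=; rewrite edge_irrefl. Qed.

Definition tyshkevich_comp : sgraph :=
  @SGraph (Sp + G)%type comp_edge comp_edge_sym comp_edge_irrefl.

End Composition.

Definition adjmx (R : realFieldType) (G : sgraph) : 'M[R]_#|G| :=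
  \matrix_(i, j) (edge (enum_val i) (enum_val j))%:R.

Definition nonsingular (R : realFieldType) (G : sgraph) : Prop :=
  adjmx R G \in unitmx.

(* Main.v *)
(** Write the adjacency matrix of [Sp(K,S)] in blocks [[J - I, B], [B^T, 0]],
    with [B] square.  A vector [x] on [S] with [B x = 0] extends by zero to the
    kernel of [Sp], and conversely the [S]-rows followed by the [K]-rows force a
    kernel vector to vanish when [B] is invertible: so [Sp] is nonsingular iff
    [B] is.  In a kernel vector of the composition the [S]-rows are untouched, so
    invertibility of [B] kills the [K]-part, hence decouples the rows of [Sp']
    from [Sp]; then the [Sp']-part vanishes, and finally the [S]-part.
    Conversely, the zero-extension argument gives invertibility of [B], and a
    kernel vector [x'] of [B'] extends to one of the composition, the [S]-part
    being the solution [y] of [B y = - (sum of x') 1]. *)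
Require Import Defs.
From mathcomp Require Import all_boot all_order all_algebra.

Set Implicit Arguments.
Unset Strict Implicit.
Unset Printing Implicit Defensive.

Import GRing.Theory.
Local Open Scope ring_scope.

Section Submatrix.
Variables (F : fieldType) (I J : finType) (M : I -> J -> F).

Definition pred_mx (A : {pred I}) (B : {pred J}) : 'M[F]_(#|A|, #|B|) :=
  \matrix_(i, j) M (enum_val i) (enum_val j).

(** Vectors are functions on the whole index type whose values off [A] are irrelevant, so later
    arguments avoid ordinals. *)
Definition row_indep (A : {pred I}) (B : {pred J}) : Prop :=
  forall x : I -> F, {in B, forall j, \sum_(i in A) x i * M i j = 0} ->
  {in A, forall i, x i = 0}.

Lemma row_of_enum_val (A : {pred I}) (v : 'rV[F]_#|A|) :
  exists x : I -> F, v = \row_k x (enum_val k).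
Proof.
(* By injectivity of [enum_val] the sum has one term on [A]; off [A] it is empty, giving the default
   0. *)
exists (fun i => \sum_(k < #|A| | enum_val k == i) v 0 k).
apply/rowP => k; rewrite mxE (big_pred1 k) // => l.
exact: inj_eq enum_val_inj _ _.
Qed.

Lemma row_mul_pred_mx (A : {pred I}) (B : {pred J}) (x : I -> F) :
  \row_k x (enum_val k) *m pred_mx A B =
  \row_k \sum_(i in A) x i * M i (enum_val k).
Proof.
apply/rowP => k; rewrite !mxE [RHS]big_enum_val.
by apply: eq_bigr => i _; rewrite !mxE.
Qed.

Lemma row_free_pred_mx (A : {pred I}) (B : {pred J}) :
  row_free (pred_mx A B) <-> row_indep A B.
Proof.
split=> [freeM x x0 i iA | indM].
  have /eqP : \row_k x (enum_val k) *m pred_mx A B = 0.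
    by rewrite row_mul_pred_mx; apply/rowP => k; rewrite !mxE x0 ?enum_valP.
  rewrite mulmx_free_eq0 // => /eqP/rowP/(_ (enum_rank_in iA i)).
  by rewrite !mxE enum_rankK_in.
apply: inj_row_free => v; have [x ->] := row_of_enum_val v.
rewrite row_mul_pred_mx => /rowP x0; apply/rowP => k; rewrite !mxE.
apply: (indM x); last exact: enum_valP.
by move=> j jB; have := x0 (enum_rank_in jB j); rewrite !mxE enum_rankK_in.
Qed.

Lemma row_full_of_indep (A : {pred I}) (B : {pred J}) :
  #|A| = #|B| -> row_indep A B -> row_full (pred_mx A B).
Proof. by move=> cardAB /row_free_pred_mx/eqP rankM; rewrite /row_full rankM cardAB. Qed.

(** A square block of full row rank also has full column rank, so every right-hand side is
    reached. *)
Lemma row_indep_solve (A : {pred I}) (B : {pred J}) (c : J -> F) :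
  #|A| = #|B| -> row_indep A B ->
  exists y : I -> F, {in B, forall j, \sum_(i in A) y i * M i j = c j}.
Proof.
move=> cardAB /(row_full_of_indep cardAB) fullM.
have /submxP[v] := submx_full (\row_(k < #|B|) c (enum_val k)) fullM.
have [y ->] := row_of_enum_val v; rewrite row_mul_pred_mx => /rowP yc.
exists y => j jB; have := yc (enum_rank_in jB j).
by rewrite !mxE enum_rankK_in.
Qed.

End Submatrix.

Lemma row_indep_flip (F : fieldType) (I J : finType) (M : I -> J -> F)
    (A : {pred I}) (B : {pred J}) :
  #|A| = #|B| -> row_indep M A B -> row_indep (fun j i => M i j) B A.
Proof.
move=> cardAB /(row_full_of_indep cardAB) fullM; apply/row_free_pred_mx.
rewrite (_ : pred_mx _ _ _ = (pred_mx M A B)^T); last by apply/matrixP=> i j; rewrite !mxE.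
by rewrite /row_free mxrank_tr; exact: fullM.
Qed.

Section Graphs.
Variable R : realFieldType.

Definition adj (G : sgraph) (u v : G) : R := (edge u v)%:R.

Lemma adjC (G : sgraph) (u v : G) : adj u v = adj v u.
Proof. by rewrite /adj edge_sym. Qed.

Lemma nonsingularP (G : sgraph) :
  nonsingular R G <->
  forall f : G -> R, (forall u, \sum_v f v * adj v u = 0) -> forall u, f u = 0.
Proof.
rewrite /nonsingular -row_free_unit (_ : adjmx R G = pred_mx (@adj G) G G) //.
split=> [/row_free_pred_mx indG f f0 u | H].
  by apply: (indG f) => // v _; rewrite f0.
by apply/row_free_pred_mx => f f0 u _; apply: H => v; apply: f0.
Qed.

(** The two halves of a kernel vector interact only through two scalars: the total of [g], and the
    sum of [f] over the clique. *)
Lemma nonsingular_compP (Sp : split_graph) (G : sgraph) :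
  nonsingular R (tyshkevich_comp Sp G) <->
  forall (f : Sp -> R) (g : G -> R),
    (forall u, \sum_v f v * adj v u + (\sum_w g w) * (u \in Kpart Sp)%:R = 0) ->
    (forall w, \sum_(v in Kpart Sp) f v + \sum_z g z * adj z w = 0) ->
  (forall u, f u = 0) /\ (forall w, g w = 0).
Proof.
have rowl (h : tyshkevich_comp Sp G -> R) u :
    \sum_v h v * adj v (inl u : tyshkevich_comp Sp G) =
    \sum_v h (inl v) * adj v u + (\sum_w h (inr w)) * (u \in Kpart Sp)%:R.
  by rewrite big_sumType /= mulr_suml.
have rowr (h : tyshkevich_comp Sp G -> R) w :
    \sum_v h v * adj v (inr w : tyshkevich_comp Sp G) =
    \sum_(v in Kpart Sp) h (inl v) + \sum_z h (inr z) * adj z w.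
  rewrite big_sumType /= [in RHS]big_mkcond; congr (_ + _).
  by apply: eq_bigr => v _; rewrite /adj /=; case: ifP; rewrite ?mulr1 ?mulr0.
apply: (iff_trans (nonsingularP _)); split=> [H f g fE gE | H h hE].
  pose h (v : tyshkevich_comp Sp G) := match v with inl u => f u | inr w => g w end.
  have h0 : forall v, h v = 0 by apply: H => -[u|w]; rewrite ?rowl ?rowr.
  by split=> [u | w]; [apply: (h0 (inl u)) | apply: (h0 (inr w))].
have [||h1 h2] := H (fun u => h (inl u)) (fun w => h (inr w)).
- by move=> u; rewrite -rowl hE.
- by move=> w; rewrite -rowr hE.
by case=> [u|w]; [apply: h1 | apply: h2].
Qed.

Section Split.
Variable Sp : split_graph.
Local Notation K := (Kpart Sp).
Local Notation S := (Spart Sp).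

Lemma notin_Kpart (v : Sp) : (v \notin K) = (v \in S).
Proof.
have [KS dKS _ _ _] := split_partition Sp.
have := in_setT v; rewrite -KS inE; case: (boolP (v \in K)) => //= vK _.
by rewrite (disjointFr dKS vK).
Qed.

Lemma sum_split (F : Sp -> R) :
  \sum_v F v = \sum_(v in K) F v + \sum_(v in S) F v.
Proof.
by rewrite (bigID (mem K)) /=; congr (_ + _); apply: eq_bigl => v; rewrite notin_Kpart.
Qed.

Lemma sum_adj_Spart (f : Sp -> R) (u : Sp) : u \in S ->
  \sum_v f v * adj v u = \sum_(v in K) f v * adj v u.
Proof.
have [_ _ _ _ [_ indS]] := split_partition Sp.
move=> uS; rewrite sum_split [X in _ + X]big1 ?addr0 // => v vS.
by rewrite /adj (negPf (indS _ _ vS uS)) mulr0.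
Qed.

Definition Szero_ext (x : Sp -> R) (v : Sp) : R := if v \in S then x v else 0.

Lemma sum_adj_Szero_ext (x : Sp -> R) (u : Sp) :
  \sum_v Szero_ext x v * adj v u =
  if u \in K then \sum_(v in S) x v * adj v u else 0.
Proof.
have [_ _ _ _ [_ indS]] := split_partition Sp.
transitivity (\sum_(v in S) x v * adj v u).
  rewrite [RHS]big_mkcond; apply: eq_bigr => v _.
  by rewrite /Szero_ext; case: ifP; rewrite ?mul0r.
case: ifPn => //; rewrite notin_Kpart => uS; apply: big1 => v vS.
by rewrite /adj (negPf (indS _ _ vS uS)) mulr0.
Qed.

Hypothesis cardKS : #|K| = #|S|.

(** This passes from injectivity of [B] to that of its transpose; symmetry of [adj] identifies the
    flipped block. *)
Lemma row_indep_KS : row_indep (@adj Sp) S K -> row_indep (@adj Sp) K S.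
Proof.
move=> /(row_indep_flip (esym cardKS)) indK x x0; apply: indK => j jS.
by rewrite -[RHS](x0 j jS); apply: eq_bigr => i _; rewrite adjC.
Qed.

Lemma nonsingular_split : nonsingular R Sp <-> row_indep (@adj Sp) S K.
Proof.
apply: (iff_trans (nonsingularP _)); split=> [H x x0 v vS | indS f f0].
  have := H (Szero_ext x) _ v; rewrite {2}/Szero_ext vS; apply=> u.
  by rewrite sum_adj_Szero_ext; case: ifP => // uK; apply: x0.
have fK : {in K, forall u, f u = 0}.
  by apply: (row_indep_KS indS) => u uS; rewrite -sum_adj_Spart.
have fS : {in S, forall u, f u = 0}.
  apply: indS => u _; rewrite -[RHS](f0 u) sum_split [X in X + _]big1 ?add0r //.
  by move=> v vK; rewrite fK ?mul0r.
by move=> u; case: (boolP (u \in K)) => [/fK//|]; rewrite notin_Kpart => /fS.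
Qed.

End Split.
End Graphs.

Theorem theorem7p2 (R : realFieldType) (Sp Sp' : split_graph)
    (hSp : #|Kpart Sp| = #|Spart Sp|) (hSp' : #|Kpart Sp'| = #|Spart Sp'|) :
  nonsingular R (tyshkevich_comp Sp Sp') <->
  nonsingular R Sp /\ nonsingular R Sp'.
Proof.
apply: (iff_trans (nonsingular_compP _ _ _)); split=> [H | [nsSp nsSp'] f g fE gE].
  have indS : row_indep (@adj R Sp) (Spart Sp) (Kpart Sp).
    move=> x x0 v vS; have [||+ _] := H (Szero_ext x) (fun=> 0).
    - move=> u; rewrite sum_adj_Szero_ext [X in X * _]big1 // mul0r addr0.
      by case: ifP => // uK; apply: x0.
    - move=> w; rewrite !big1 ?addr0 // => z zP; rewrite ?mul0r //.
      by rewrite /Szero_ext -notin_Kpart zP.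
    by move/(_ v); rewrite /Szero_ext vS.
  split; first exact/(nonsingular_split _ hSp).
  apply/(nonsingular_split _ hSp') => x x0 v vS.
  pose s := \sum_w Szero_ext x w.
  (* Each clique vertex of [Sp] receives [s] from [Sp'], and [y] cancels it. Being supported on the
     independent part, [y] adds nothing to the rows of [Sp']. *)
  have [y yE] := row_indep_solve (fun=> - s) (esym hSp) indS.
  have [||_ /(_ v)] := H (Szero_ext y) (Szero_ext x); last by rewrite /Szero_ext vS.
  - move=> u; rewrite sum_adj_Szero_ext -/s.
    by case: ifP => [uK|_]; rewrite ?mulr0 ?addr0 // mulr1 yE // addNr.
  - move=> w; rewrite sum_adj_Szero_ext big1 ?add0r => [|z zK].
      by case: ifP => // wK; apply: x0.
    by rewrite /Szero_ext -notin_Kpart zK.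
have indK := row_indep_KS hSp ((nonsingular_split R hSp).1 nsSp).
have fK : {in Kpart Sp, forall u, f u = 0}.
  (* The coupling term is absent from rows outside the clique. *)
  apply: indK => u uS; rewrite -sum_adj_Spart //.
  by move: (fE u); rewrite -notin_Kpart in uS; rewrite (negPf uS) mulr0 addr0.
have g0 : forall w, g w = 0.
  apply: ((nonsingularP R Sp').1 nsSp') => w.
  (* Since [f] vanishes on the clique, [g] lies in the kernel of [Sp']. *)
  by have := gE w; rewrite [X in X + _]big1 ?add0r.
split=> //; apply: ((nonsingularP R Sp).1 nsSp) => u.
(* With [g] zero its total vanishes, leaving [f] in the kernel of [Sp]. *)
by have := fE u; rewrite [X in X * _]big1 ?mul0r ?addr0.
Qed.
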